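(* Let $X$ be a compact Hausdorff space. Then $C_p(X)$ has an infinite-dimensional Hausdorff separable linear quotient if and only if it has an infinite-dimensional Hausdorff metrisable linear quotient.
   Context: $C_p(X)$ is the real vector space $C(X)$ of continuous functions $X\to\mathbb R$ with the topology of pointwise convergence. A linear quotient of $C_p(X)$ is a quotient vector space $C_p(X)/Z$ by a linear subspace $Z$, with the quotient topology (it is Hausdorff exactly when $Z$ is closed). The quotient is separable (metrisable) if it is separable (metrisable) as a topological space. *)

(* Defs.v *)
From HB Require Import structures.
From mathcomp Require Import all_boot all_order all_algebra.
From mathcomp Require Import all_classical all_reals all_analysis.
Import Order.TTheory GRing.Theory Num.Theory.
Import numFieldNormedType.Exports.

Set Implicit Arguments.
Unset Strict Implicit.
Unset Printing Implicit Defensive.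

Local Open Scope classical_set_scope.
Local Open Scope ring_scope.
Local Open Scope quotient_scope.

(* [continuousType X R] carries no canonical topology or vector space         *)
(* structure; the alias [Cp X R] receives both.                               *)
Definition Cp (X : topologicalType) (R : realType) : Type := continuousType X R.
Identity Coercion Cp_continuousType : Cp >-> Continuous.type.

Section Cp.
Context (X : topologicalType) (R : realType).

Definition cts_pred : {pred X -> R} := fun f => `[< continuous f >].

Definition Cp_val (f : Cp X R) : X -> R := f.

Fact Cp_valP (f : Cp X R) : Cp_val f \in cts_pred.
Proof. by apply/asboolP; exact: cts_fun. Qed.

Definition Cp_sub (f : X -> R) (cf : f \in cts_pred) : Cp X R :=
  mkcts (elimT (asboolP _) cf).

Fact Cp_subP K (_ : forall f cf, K (@Cp_sub f cf)) u : K u.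
Proof.
have -> // : u = Cp_sub (Cp_valP u).
exact/(@continuousEP X R).
Qed.

HB.instance Definition _ := Choice.copy (Cp X R) (continuousType X R).
HB.instance Definition _ :=
  @isSub.Build _ _ (Cp X R) Cp_val _ Cp_subP (fun _ _ => erefl).

Fact cts_pred_submod_closed : submod_closed cts_pred.
Proof.
split=> [|a f g /asboolP cf /asboolP cg]; apply/asboolP => x.
  exact: cst_continuous.
by apply: cvgD; [apply: cvgM; [exact: cvg_cst|exact: cf]|exact: cg].
Qed.

HB.instance Definition _ :=
  GRing.isSubmodClosed.Build R (X -> R) cts_pred cts_pred_submod_closed.

HB.instance Definition _ := [SubChoice_isSubLmodule of Cp X R by <:].

HB.instance Definition _ := Topological.copy (Cp X R)
  (initial_topology (Cp_val : Cp X R -> {ptws X -> R})).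

End Cp.

Section linear_quotient.
Context (R : numDomainType) (V : preTopologicalLmodType R) (Z : submodClosed V).

(* A [submodClosed] predicate is not canonically a [zmodClosed] one, which    *)
(* is what [Quotient.quot] expects.                                           *)
Definition subspace_pred : {pred V} := Z.

Fact subspace_zmod_closed : zmod_closed subspace_pred.
Proof. exact: GRing.submod_closedB (submodClosedP Z). Qed.

HB.instance Definition _ :=
  GRing.isZmodClosed.Build V subspace_pred subspace_zmod_closed.

Definition linear_quotient : Type :=
  quotient_topology (Quotient.quot subspace_pred).

HB.instance Definition _ := Quotient.on linear_quotient.
HB.instance Definition _ := Topological.on linear_quotient.
(* The choice structures of [quotient_topology] and [Quotient.quot] differ,   *)
(* hence the group structure of the latter cannot just be copied.             *)
HB.instance Definition _ := GRing.isZmodule.Build linear_quotient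
  (@Quotient.addqA V subspace_pred) (@Quotient.addqC V subspace_pred)
  (@Quotient.add0q V subspace_pred) (@Quotient.addNq V subspace_pred).

Fact linear_quotient_eqP (x y : V) :
  reflect (x = y %[mod linear_quotient]) (x - y \in Z).
Proof.
have -> : (x - y \in Z) = (x - y \in subspace_pred) by [].
by rewrite Quotient.idealrBE; apply: (iffP eqP) => xy; exact: xy.
Qed.

Definition linear_quotient_scale (a : R) (q : linear_quotient) :
  linear_quotient := \pi_linear_quotient (a *: repr q).

Fact linear_quotient_piZ (a : R) (x : V) :
  linear_quotient_scale a (\pi_linear_quotient x)
  = \pi_linear_quotient (a *: x).
Proof.
apply/linear_quotient_eqP; rewrite -scalerBr rpredZ//.
by apply/linear_quotient_eqP; rewrite reprK.
Qed.

Fact linear_quotient_piD (x y : V) :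
  \pi_linear_quotient (x + y) =
  \pi_linear_quotient x + \pi_linear_quotient y.
Proof. exact: (@Quotient.pi_add V subspace_pred). Qed.

Fact linear_quotient_scaleA a b q :
  linear_quotient_scale a (linear_quotient_scale b q)
  = linear_quotient_scale (a * b) q.
Proof.
by rewrite -[q]reprK (linear_quotient_piZ b) !linear_quotient_piZ scalerA.
Qed.

Fact linear_quotient_scale1 : left_id 1 linear_quotient_scale.
Proof. by move=> q; rewrite -[q]reprK linear_quotient_piZ scale1r. Qed.

Fact linear_quotient_scaleDr : right_distributive linear_quotient_scale +%R.
Proof.
move=> a p q; rewrite -[p]reprK -[q]reprK -linear_quotient_piD.
by rewrite !linear_quotient_piZ scalerDr linear_quotient_piD.
Qed.

Fact linear_quotient_scaleDl q :
  {morph linear_quotient_scale^~ q : a b / a + b}.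
Proof.
move=> a b; rewrite -[q]reprK.
by rewrite !linear_quotient_piZ scalerDl linear_quotient_piD.
Qed.

HB.instance Definition _ := GRing.Zmodule_isLmodule.Build R linear_quotient
  linear_quotient_scaleA linear_quotient_scale1
  linear_quotient_scaleDr linear_quotient_scaleDl.

End linear_quotient.

Definition finite_dimensional (R : pzRingType) (V : lmodType R) : Prop :=
  exists (n : nat) (e : 'I_n -> V),
    forall v : V, exists c : 'I_n -> R, v = \sum_(i < n) c i *: e i.

Definition infinite_dimensional (R : pzRingType) (V : lmodType R) : Prop :=
  ~ finite_dimensional V.

Definition separable_space (T : topologicalType) : Prop :=
  exists2 D : set T, countable D & dense D.

Definition metrisable_space (R : realType) (T : topologicalType) : Prop :=
  exists d : T -> T -> R,
    [/\ forall x, d x x = 0,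
        forall x y, d x y = 0 -> x = y,
        forall x y, d x y = d y x,
        forall y x z, d x z <= d x y + d y z
      & forall x : T,
          nbhs x = filter_from [set e : R | 0 < e] (fun e => [set y | d x y < e])].

(* Main.v *)
(* The dual of C_p(X) is the space of finitely supported measures on X. If    *)
(* C_p(X)/Z is Hausdorff, infinite-dimensional and separable, then countably  *)
(* many continuous functions d_n separate the points of the annihilator of Z. *)
(* Push everything forward along Phi = (d_n)_n to the metrisable space        *)
(* nat -> R: there a countable family b_k realises every 0/1 pattern on every *)
(* finite set, so measures nu_n in the annihilator can be chosen inductively  *)
(* such that Phi nu_n gives no mass to the earlier supports and kills more    *)
(* and more of the b_k. The span of (nu_n) is weak* closed: if mu is in its   *)
(* closure and a_n are its coefficients, sign patterns bound                  *)
(* \sum_n |a_n| |Phi nu_n| by the total variation of mu, and then a bump at   *)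
(* an atom of Phi nu_n that misses Phi (supp mu) shows a_n = 0; so mu is a    *)
(* finite combination of the nu_n. Hence the common kernel of the nu_n has a  *)
(* metrisable quotient. Conversely, a countable neighbourhood base at 0 of a  *)
(* quotient only involves countably many points of X.                         *)
Require Import Defs.
From HB Require Import structures.
From mathcomp Require Import all_boot all_order all_algebra.
From mathcomp Require Import all_classical all_reals all_analysis.
From mathcomp Require Import ring lra.
Import Order.TTheory GRing.Theory Num.Theory.
Import numFieldNormedType.Exports.

Set Implicit Arguments.
Unset Strict Implicit.
Unset Printing Implicit Defensive.

Local Open Scope classical_set_scope.
Local Open Scope ring_scope.

(** * Finitely supported measures *)

(** Everything is translated to finitely supported measures by [interpolation_dual], a
    finite-dimensional Hahn-Banach theorem. For a Hausdorff quotient, [annihilator_unspanned] and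
    [separable_annihilator] turn infinite dimension and separability into properties of the
    annihilator of Z. From these, [closed_biorthogonal_sequence] extracts measures nu_i with dual
    functions E_i such that, for every finite P and some n depending only on P, each f killed by the
    first n measures agrees on P with an element of their common kernel. By [nullspace_metrisable]
    the quotient by this kernel then carries the initial topology of the countably many nu_i, and
    biorthogonality makes it infinite-dimensional. The converse is [metrisable_separable]. *)

Section molecules.
Context (R : realType).
Implicit Type T : choiceType.

(* A list of weighted points encodes the measure \sum_p p.1 * delta_(p.2);    *)
(* points may repeat, so [mass] sums the weights at a point.                  *)
Definition ev (T : Type) (m : seq (R * T)) (f : T -> R) : R :=
  \sum_(p <- m) p.1 * f p.2.

Definition supp (T : Type) (m : seq (R * T)) : seq T := [seq p.2 | p <- m].

Definition push (T U : Type) (h : T -> U) (m : seq (R * T)) : seq (R * U) :=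
  [seq (p.1, h p.2) | p <- m].

Definition scale (T : Type) (a : R) (m : seq (R * T)) : seq (R * T) :=
  [seq (a * p.1, p.2) | p <- m].

Definition mass T (m : seq (R * T)) (y : T) : R := ev m (fun z => (z == y)%:R).

Lemma ev_lin (T : Type) (m : seq (R * T)) a f g :
  ev m (fun x => a * f x + g x) = a * ev m f + ev m g.
Proof.
rewrite /ev mulr_sumr -big_split/=; apply: eq_bigr => p _; ring.
Qed.

Lemma ev0 (T : Type) (m : seq (R * T)) : ev m (fun=> 0) = 0.
Proof. by rewrite /ev big1// => p _; rewrite mulr0. Qed.

Lemma evZ (T : Type) (m : seq (R * T)) a f :
  ev m (fun x => a * f x) = a * ev m f.
Proof. by rewrite /ev mulr_sumr; apply: eq_bigr => p _; ring. Qed.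

Lemma evB (T : Type) (m : seq (R * T)) f g :
  ev m (fun x => f x - g x) = ev m f - ev m g.
Proof. by rewrite /ev -sumrB; apply: eq_bigr => p _; ring. Qed.

Lemma ev_sum (T I : Type) (m : seq (R * T)) (r : seq I) (F : I -> T -> R) :
  ev m (fun x => \sum_(i <- r) F i x) = \sum_(i <- r) ev m (F i).
Proof.
by rewrite /ev exchange_big/=; apply: eq_bigr => p _; rewrite mulr_sumr.
Qed.

Lemma eq_ev T (m : seq (R * T)) f g :
  {in supp m, f =1 g} -> ev m f = ev m g.
Proof.
move=> fg; rewrite /ev; apply: eq_big_seq => p pm; congr (_ * _).
by apply: fg; rewrite map_f.
Qed.

Lemma ev_cat (T : Type) (m n : seq (R * T)) f :
  ev (m ++ n) f = ev m f + ev n f.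
Proof. by rewrite /ev big_cat. Qed.

Lemma ev1 (T : Type) a (x : T) f : ev [:: (a, x)] f = a * f x.
Proof. by rewrite /ev big_seq1. Qed.

Lemma ev_scale (T : Type) a (m : seq (R * T)) f :
  ev (scale a m) f = a * ev m f.
Proof.
by rewrite /ev big_map mulr_sumr; apply: eq_bigr => p _ /=; rewrite mulrA.
Qed.

Lemma ev_push (T U : Type) (h : T -> U) (m : seq (R * T)) f :
  ev (push h m) f = ev m (f \o h).
Proof. by rewrite /ev big_map. Qed.

Lemma le_ev (T : Type) (m : seq (R * T)) f :
  (forall x, `|f x| <= 1) -> `|ev m f| <= \sum_(p <- m) `|p.1|.
Proof.
move=> f1; apply: le_trans (ler_norm_sum _ _ _) _; apply: ler_sum => p _.
by rewrite normrM ler_piMr.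
Qed.

Lemma mass_notin T (m : seq (R * T)) y : y \notin supp m -> mass m y = 0.
Proof.
move=> ym; rewrite /mass -(ev0 m); apply: eq_ev => z zm.
by case: eqP => // zy; rewrite -zy zm in ym.
Qed.

Lemma ev_mass T (m : seq (R * T)) (s : seq T) f :
  uniq s -> {subset supp m <= s} -> ev m f = \sum_(y <- s) mass m y * f y.
Proof.
move=> us ms; transitivity (ev m (fun x => \sum_(y <- s) f y * (x == y)%:R)).
  apply: eq_ev => x /ms xs; rewrite (bigD1_seq x)//= eqxx mulr1n mulr1 big1 ?addr0//.
  by move=> y /negPf yx; rewrite eq_sym yx mulr0n mulr0.
by rewrite ev_sum; apply: eq_bigr => y _; rewrite evZ mulrC.
Qed.

(** Induction on s. If some g1 in Z has g1(x) = 1, the point x is removed by replacing f with f -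
    f(x) g1 and Z with its elements vanishing at x; a measure m obtained there is corrected by the
    atom -m(g1) at x. *)
Lemma interpolation_dual T (Z : set (T -> R)) (s : seq T) (f : T -> R) :
  Z (fun=> 0) ->
  (forall a g h, Z g -> Z h -> Z (fun x => a * g x + h x)) ->
  (exists2 g, Z g & {in s, g =1 f}) \/
  exists m : seq (R * T),
    [/\ {subset supp m <= s}, forall g, Z g -> ev m g = 0 & ev m f = 1].
Proof.
elim: s Z f => [|x s IHs] Z f Z0 Zlin; first by left; exists (fun=> 0).
have [[g0 Zg0 g0x]|/forall2NP Zx] := pselect (exists2 g, Z g & g x != 0); last first.
  have {}Zx g : Z g -> g x = 0.
    by move=> Zg; case: (Zx g) => // /negP; rewrite negbK => /eqP.
  have [fx0|fx0] := eqVneq (f x) 0.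
    have [[g Zg gf]|[m [ms mZ mf]]] := IHs Z f Z0 Zlin.
      left; exists g => // y; rewrite inE => /orP[/eqP->|]; last exact: gf.
      by rewrite fx0 (Zx g).
    by right; exists m; split=> // y /ms ys; rewrite inE ys orbT.
  right; exists [:: ((f x)^-1, x)]; split.
  - by move=> y; rewrite !inE => ->.
  - by move=> g Zg; rewrite ev1 (Zx g)// mulr0.
  - by rewrite ev1 mulVf.
have [g1 Zg1 g1x] : exists2 g1, Z g1 & g1 x = 1.
  by exists (fun y => (g0 x)^-1 * g0 y + 0); [exact: Zlin|rewrite addr0 mulVf].
have [||[g [Zg gx] gf]|[m [ms mZ mf]]] :=
  IHs [set g | Z g /\ g x = 0] (fun y => - f x * g1 y + f y).
- by [].
- move=> a g h [Zg gx] [Zh hx]; split; first exact: Zlin.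
  by rewrite gx hx; ring.
- left; exists (fun y => f x * g1 y + g y); first exact: Zlin.
  move=> y; rewrite inE => /orP[/eqP->|ys]; first by rewrite g1x gx; ring.
  by rewrite gf//=; ring.
right; exists (m ++ [:: (- ev m g1, x)]).
have evE h : ev (m ++ [:: (- ev m g1, x)]) h = ev m (fun y => - h x * g1 y + h y).
  by rewrite ev_cat ev_lin ev1; ring.
split.
- move=> y; rewrite /supp map_cat mem_cat => /orP[/ms ys|]; first by rewrite inE ys orbT.
  by rewrite !inE => ->.
- move=> g Zg; rewrite evE mZ//; split; first exact: Zlin.
  by rewrite g1x; ring.
- by rewrite evE mf.
Qed.

(* The functionals of W, restricted to C, form a finite-dimensional space:    *)
(* the e i span C modulo the common kernel of W.                              *)
Definition spanned (T : Type) (C : set (T -> R)) (W : set (seq (R * T))) :=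
  exists (n : nat) (e : nat -> T -> R), (forall i, C (e i)) /\
    forall f, C f -> exists c : nat -> R,
      forall m, W m -> ev m f = \sum_(i < n) c i * ev m (e i).

(** Restricting to the kernel of one further condition u costs at most one dimension. *)
Lemma spanned_kernel (T : Type) (C : set (T -> R)) (W : set (seq (R * T)))
    (u : T -> R) :
  C (fun=> 0) ->
  (forall a g h, C g -> C h -> C (fun x => a * g x + h x)) ->
  (forall a m n, W m -> W n -> W (scale a m ++ n)) ->
  spanned C [set m | W m /\ ev m u = 0] -> spanned C W.
Proof.
move=> C0 Clin Wlin [n [e [Ce spane]]].
have [[m0 Wm0 m0u]|/forall2NP Wu] := pselect (exists2 m, W m & ev m u != 0);
    last first.
  exists n, e; split=> // f /spane[c fc]; exists c => m Wm; apply: fc; split=> //.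
  by case: (Wu m) => // /negP; rewrite negbK => /eqP.
(* A functional on W that vanishes where u does is a multiple of u; the factor is read off at m0. *)
have decomp f c :
    (forall m, W m /\ ev m u = 0 -> ev m f = \sum_(i < n) c i * ev m (e i)) ->
    forall m, W m -> ev m f - \sum_(i < n) c i * ev m (e i) =
      ev m u / ev m0 u * (ev m0 f - \sum_(i < n) c i * ev m0 (e i)).
  move=> fc m Wm; set k := ev m u / ev m0 u.
  have /fc : W (scale (- k) m0 ++ m) /\ ev (scale (- k) m0 ++ m) u = 0.
    by split; [exact: Wlin|rewrite ev_cat ev_scale mulNr divfK// addNr].
  have -> : \sum_(i < n) c i * ev (scale (- k) m0 ++ m) (e i) =
      - k * (\sum_(i < n) c i * ev m0 (e i)) + \sum_(i < n) c i * ev m (e i).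
    rewrite mulr_sumr -big_split; apply: eq_bigr => i _ /=.
    by rewrite ev_cat ev_scale; ring.
  by rewrite ev_cat ev_scale => mE; lra.
(* Since u need not lie in C, it cannot simply join the [e i]. Either some g0 in C represents it
   modulo the [e i] and joins them instead, or no f in C has a component along u. *)
have [[g0 [Cg0 [d g0d] g0E]]|noE] := pselect (exists g0, [/\ C g0,
    exists d : nat -> R, forall m, W m ->
      ev m g0 = \sum_(i < n) d i * ev m (e i) + ev m u / ev m0 u & True]).
  exists n.+1, (fun i => if i is j.+1 then e j else g0); split; first by case.
  move=> f Cf; have [c /decomp fc] := spane f Cf.
  set k := ev m0 f - _ in fc.
  exists (fun i => if i is j.+1 then c j - k * d j else k) => m Wm.
  rewrite big_ord_recl/= g0d//.
  under eq_bigr do rewrite mulrBl -mulrA.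
  rewrite sumrB -mulr_sumr mulrDr; have := fc _ Wm.
  move=> /eqP; rewrite subr_eq => /eqP ->; ring.
exists n, e; split=> // f Cf; have [c /decomp fc] := spane f Cf.
exists c => m Wm; have /eqP := fc m Wm; set k := ev m0 f - _ in fc *.
have [->|k0] := eqVneq k 0; first by rewrite mulr0 subr_eq0 => /eqP.
exfalso; apply: noE; exists (fun x => k^-1 * f x + 0); split => //.
  exact: Clin.
exists (fun i => k^-1 * c i) => m' Wm'; under eq_bigr do rewrite -mulrA.
rewrite -mulr_sumr ev_lin ev0 addr0; have /eqP := fc _ Wm'; rewrite subr_eq.
by move=> /eqP ->; field; apply/andP.
Qed.

Lemma unspanned_nonzero (T : choiceType) (C : set (T -> R))
    (W : set (seq (R * T))) (u : seq (T -> R)) :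
  C (fun=> 0) ->
  (forall a g h, C g -> C h -> C (fun x => a * g x + h x)) ->
  (forall a m n, W m -> W n -> W (scale a m ++ n)) ->
  ~ spanned C W ->
  exists m, [/\ W m, {in u, forall g, ev m g = 0} & exists2 f, C f & ev m f != 0].
Proof.
move=> C0 Clin; elim: u W => [|g u IHu] W Wlin nsW.
  apply: contrapT => noW; apply: nsW; exists 0%N, (fun=> fun=> 0); split=> // f Cf.
  exists (fun=> 0) => m Wm; rewrite big_ord0; apply: contrapT => /eqP mf0.
  by apply: noW; exists m; split=> //; exists f.
have [||m [[Wm mg] mu mf]] := IHu [set m | W m /\ ev m g = 0].
- move=> a m n [Wm mg] [Wn ng]; split; first exact: Wlin.
  by rewrite ev_cat ev_scale mg ng mulr0 addr0.
- by move=> /(spanned_kernel C0 Clin Wlin).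
by exists m; split=> // h; rewrite inE => /orP[/eqP->|/mu].
Qed.

End molecules.

(** * Sequences with weak* closed span *)

Lemma summable_tail (R : realType) (u : nat -> R) (B eta : R) (i : nat) :
  (forall j, 0 <= u j) -> (forall n, \sum_(0 <= j < n) u j <= B) -> 0 < eta ->
  exists2 n, (i <= n)%N & forall m, \sum_(n <= j < m) u j < eta.
Proof.
move=> u0 uB eta0; pose S := range (fun n => \sum_(0 <= j < n) u j).
have supS : has_sup S.
  by split; [exists (\sum_(0 <= j < 0) u j), 0%N|exists B => _ [n _ <-]].
have [_ [n1 _ <-] n1S] := sup_adherent eta0 supS.
exists (maxn i n1); first exact: leq_maxl.
move=> m; have [mn|/ltnW nm] := leqP m (maxn i n1); first by rewrite big_geq.
have : \sum_(0 <= j < m) u j <= sup S by apply: sup_upper_bound => //; exists m.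
rewrite (big_cat_nat (leq0n _) nm)//= (big_cat_nat (leq0n _) (leq_maxr i n1))//=.
have : 0 <= \sum_(n1 <= j < maxn i n1) u j by rewrite sumr_ge0.
lra.
Qed.

Section biorthogonal.
Context (R : realType) (X M : choiceType) (Phi : X -> M).
Context (C Z : set (X -> R)) (b : nat -> M -> R).
Context (C0 : C (fun=> 0)).
Context (Clin :
  forall a g h, C g -> C h -> C (fun x => a * g x + h x)).
Context (b01 : forall k y, 0 <= b k y <= 1).
Context (b_pattern : forall (T : seq M) (p : M -> bool),
  exists k, {in T, forall y, b k y = (p y)%:R}).
Context (Cb : forall k, C (b k \o Phi)).

Let annih : set (seq (R * X)) := [set m | forall f, Z f -> ev m f = 0].

Context (annih_inj : forall m, annih m -> (forall g, ev m (g \o Phi) = 0) ->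
  forall f, C f -> ev m f = 0).
Context (annih_unspanned : ~ spanned C annih).
Context (ZC : forall f, Z f -> C f).

Let annih_lin a m n : annih m -> annih n -> annih (scale a m ++ n).
Proof.
by move=> Zm Zn f Zf; rewrite ev_cat ev_scale Zm// Zn// mulr0 addr0.
Qed.

Lemma patterns_bounded (T : seq M) : exists K, forall p : M -> bool,
  exists2 k, (k < K)%N & {in T, forall y, b k y = (p y)%:R}.
Proof.
have /choice[kk kkP] (t : {ffun seq_sub T -> bool}) :
    exists k, forall y (Ty : y \in T), b k y = (t (SeqSub Ty))%:R.
  have [k kP] := b_pattern T (fun y => if insub y is Some z then t z else false).
  by exists k => y Ty; rewrite kP// insubT.
exists (\max_t kk t).+1 => p; pose t := [ffun z : seq_sub T => p (ssval z)].
exists (kk t); first by rewrite ltnS (leq_bigmax t).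
by move=> y Ty; rewrite (kkP t _ Ty) ffunE.
Qed.

Lemma b_total (m : seq (R * M)) : (forall k, ev m (b k) = 0) ->
  forall g, ev m g = 0.
Proof.
move=> mb g; rewrite (ev_mass g (undup_uniq (supp m))); last first.
  by move=> y; rewrite mem_undup.
rewrite big1// => y _; have [k kP] := b_pattern (supp m) (pred1 y).
suff -> : mass m y = ev m (b k) by rewrite mb mul0r.
by apply: eq_ev => z zm; rewrite kP.
Qed.

(** Vanishing on the points of T and on the first K functions [b k] amounts to finitely many
    conditions, which leave some m nonzero on C; [annih_inj] then forces its image to have an
    atom. *)
Lemma massive_annihilator (T : seq M) (K : nat) :
  exists m, [/\ annih m, {in T, forall y, mass (push Phi m) y = 0},
    forall k, (k < K)%N -> ev (push Phi m) (b k) = 0 &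
    exists y, mass (push Phi m) y != 0].
Proof.
have [m [Zm mu [f Cf mf]]] := unspanned_nonzero
  ([seq (fun x => (Phi x == y)%:R) | y <- T] ++ [seq b k \o Phi | k <- iota 0 K])
  C0 Clin annih_lin annih_unspanned.
exists m; split=> //.
- move=> y Ty; rewrite /mass ev_push; apply: mu; rewrite mem_cat.
  by apply/orP; left; apply/mapP; exists y.
- move=> k kK; rewrite ev_push; apply: mu; rewrite mem_cat.
  by apply/orP; right; apply/mapP; exists k; rewrite ?mem_iota.
apply: contrapT => /forallNP m0; move/eqP: mf; apply.
apply: annih_inj => // g; rewrite -ev_push.
rewrite (ev_mass g (undup_uniq (supp (push Phi m)))); last first.
  by move=> y; rewrite mem_undup.
rewrite big1// => y _; have /negP := m0 y; rewrite negbK => /eqP ->.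
by rewrite mul0r.
Qed.

(* T n collects the supports of the N j with j < n, and every 0/1 pattern on  *)
(* T n.+1 is realised by some b k with k < K n.+1, which N j kills for j > n. *)
Lemma massive_sequence :
  exists (nu : nat -> seq (R * X)) (T : nat -> seq M) (K : nat -> nat)
      (y : nat -> M), let N n := push Phi (nu n) in
  [/\ [/\ forall n, annih (nu n),
          forall n, {subset supp (N n) <= T n.+1},
          forall n, {subset T n <= T n.+1},
          forall n, {in T n, forall z, mass (N n) z = 0} &
          forall n k, (k < K n)%N -> ev (N n) (b k) = 0],
     forall n, mass (N n) (y n) != 0,
     forall n (p : M -> bool),
       exists2 k, (k < K n.+1)%N & {in T n.+1, forall z, b k z = (p z)%:R} &
     forall n, (K n < K n.+1)%N].
Proof.
have /choice[kappa kappaP] := patterns_bounded.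
have /choice[sigma sigmaP] : forall s : seq M * nat, exists m,
    [/\ annih m, {in s.1, forall y, mass (push Phi m) y = 0},
    forall k, (k < s.2)%N -> ev (push Phi m) (b k) = 0 &
    exists y, mass (push Phi m) y != 0].
  by move=> s; exact: massive_annihilator.
pose next (s : seq M * nat) := let T := s.1 ++ supp (push Phi (sigma s)) in
  (T, maxn s.2.+1 (kappa T)).
pose st n := iter n next ([::], 0%N).
have /choice[y yP] : forall n, exists y, mass (push Phi (sigma (st n))) y != 0.
  by move=> n; have [] := sigmaP (st n).
exists (sigma \o st), (fun n => (st n).1), (fun n => (st n).2), y; split=> //.
- split=> n; try by have [] := sigmaP (st n).
  + by move=> z /= zs; rewrite mem_cat zs orbT.
  + by move=> z /= zs; rewrite mem_cat zs.
- move=> n p; have [k kK kp] := kappaP (st n.+1).1 p; exists k => //.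
  by apply: leq_trans kK _; rewrite /= leq_maxr.
- by move=> n; rewrite /= leq_maxl.
Qed.

(* The last clause says that the span of the nu i is weak* closed, the g      *)
(* interpolating f on P being dual to the measures supported in P.            *)
Lemma closed_biorthogonal_sequence :
  exists (nu : nat -> seq (R * X)) (E : nat -> X -> R),
    [/\ forall i, C (E i), forall i j, ev (nu i) (E j) = (i == j)%:R &
     forall P : seq X, exists n, forall f, C f ->
       (forall i, (i < n)%N -> ev (nu i) f = 0) ->
       exists g, [/\ C g, forall i, ev (nu i) g = 0 & {in P, g =1 f}]].
Proof.
have [nu [T [K [y [[nuZ suppT Tsub massT Kb] massy patT Kmono]]]]] :=
  massive_sequence.
set N := fun n => push Phi (nu n).
have TS i j : (i <= j)%N -> {subset T i <= T j}.
  move=> /subnK <-; elim: (j - i)%N => // d IHd z /IHd; exact: Tsub.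
have KS i j : (i <= j)%N -> (K i <= K j)%N.
  move=> /subnK <-; elim: (j - i)%N => // d IHd.
  by apply: leq_trans IHd _; rewrite addSn ltnW.
have Kge i : (i <= K i)%N by elim: i => // i IHi; exact: leq_ltn_trans (Kmono i).
have massTS i j z : (i <= j)%N -> z \in T i -> mass (N j) z = 0.
  by move=> ij /(TS _ _ ij); exact: massT.
have mem_mass i z : mass (N i) z != 0 -> z \in T i.+1.
  by move=> /negP mz; apply/suppT; apply: contrapT => /negP /mass_notin /eqP.
have mass_disj i j z : mass (N i) z != 0 -> i != j -> mass (N j) z = 0.
  move=> mi; rewrite neq_ltn => /orP[ij|ji]; first exact: massTS ij (mem_mass _ _ mi).
  apply: contrapT => /eqP /mem_mass /(massTS _ i _ ji) mi0.
  by rewrite mi0 eqxx in mi.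
have Nb i j k : (i <= j)%N -> (k < K i)%N -> ev (N j) (b k) = 0.
  by move=> ij ki; apply: Kb; apply: leq_trans ki (KS _ _ ij).
have Nmass i n f : (i < n)%N ->
    ev (N i) f = \sum_(z <- undup (T n)) mass (N i) z * f z.
  move=> iln; apply: ev_mass; first exact: undup_uniq.
  by move=> z /suppT /(TS _ _ iln); rewrite mem_undup.
(* The bound on [kE i] makes every later N j kill this function, while on [T i.+1], which carries N
   0, ..., N i, it is the indicator of [y i]. Together these give biorthogonality. *)
have /choice[kE kEP] : forall i, exists k,
    (k < K i.+1)%N /\ {in T i.+1, forall z, b k z = (z == y i)%:R}.
  by move=> i; have [k kK kP] := patT i (pred1 (y i)); exists k.
pose E i x := (mass (N i) (y i))^-1 * b (kE i) (Phi x) + 0.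
have CE i : C (E i) by apply: Clin; [exact: Cb|exact: C0].
have nuE i j : ev (nu i) (E j) = (i == j)%:R.
  rewrite ev_lin ev0 addr0 -[X in _ * X](ev_push Phi _ (b _)) -/(N i).
  have [kK kP] := kEP j; have [ji|ij] := ltnP j i.
    by rewrite (Nb j.+1)// mulr0 gtn_eqF.
  rewrite (_ : ev _ _ = mass (N i) (y j)); last first.
    by apply: eq_ev => z /suppT /(TS _ _ (ij : i < j.+1)%N) /kP.
  have [->|ji] := eqVneq i j; first by rewrite mulVf// massy.
  by rewrite (mass_disj j i) ?mulr0 ?massy// eq_sym.
exists nu, E; split=> //.
pose Z' := [set g | C g /\ forall i, ev (nu i) g = 0].
have Z'0 : Z' (fun=> 0) by split=> // i; rewrite ev0.
have Z'lin a g h : Z' g -> Z' h -> Z' (fun x => a * g x + h x).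
  move=> [Cg Zg] [Ch Zh]; split=> [|i]; first exact: Clin.
  by rewrite ev_lin Zg Zh mulr0 addr0.
have Csum n (c : nat -> R) f : C f -> C (fun x => \sum_(i < n) c i * E i x + f x).
  move=> Cf; elim: n => [|n IHn].
    by under eq_fun do rewrite big_ord0 add0r.
  under eq_fun do rewrite big_ord_recr/= -addrA addrCA.
  exact: Clin.
(* Subtracting from f its components along the E i with i < n lands in Z', where mu vanishes. *)
have expand mu n f : (forall g, Z' g -> ev mu g = 0) -> C f ->
    (forall j, (n <= j)%N -> ev (nu j) f = 0) ->
    ev mu f = \sum_(i < n) ev (nu i) f * ev mu (E i).
  move=> mu0 Cf fn.
  have evE m : ev m (fun x => \sum_(i < n) - ev (nu i) f * E i x + f x) =
      ev m f - \sum_(i < n) ev (nu i) f * ev m (E i).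
    transitivity (ev m (fun x => f x - \sum_(i < n) ev (nu i) f * E i x)).
      apply: eq_bigr => p _; congr (_ * _); rewrite addrC -sumrN; congr (_ + _).
      by apply: eq_bigr => i _; rewrite mulNr.
    by rewrite evB ev_sum; congr (_ - _); apply: eq_bigr => i _; rewrite evZ.
  apply/eqP; rewrite -subr_eq0 -evE; apply/eqP/mu0; split.
    exact: (Csum n (fun i => - ev (nu i) f)).
  move=> j; rewrite evE; under eq_bigr do rewrite nuE.
  have [nj|jn] := leqP n j.
    by rewrite fn// sub0r big1 ?oppr0// => i _; rewrite gtn_eqF ?mulr0//
      (leq_trans _ nj).
  rewrite (bigD1 (Ordinal jn))//= eqxx mulr1 big1 ?addr0 ?subrr// => i.
  by rewrite -val_eqE/= eq_sym => /negPf ->; rewrite mulr0.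
pose w i := \sum_(z <- undup (T i.+1)) `|mass (N i) z|.
have le_w i f : (forall z, `|f z| <= 1) -> `|ev (N i) f| <= w i.
  move=> f1; rewrite (Nmass i i.+1)//; apply: le_trans (ler_norm_sum _ _ _) _.
  by apply: ler_sum => z _; rewrite normrM ler_piMr.
have a_bound mu n : (forall g, Z' g -> ev mu g = 0) ->
    \sum_(0 <= i < n) `|ev mu (E i)| * w i <= \sum_(p <- mu) `|p.1|.
  move=> mu0; case: n => [|n]; first by rewrite big_geq// sumr_ge0.
  (* The N i live on disjoint sets, so a single function h with values in     *)
  (* [-1, 1] matches the signs of all a_i * N i at once.                      *)
  pose l z := \sum_(j < n.+1) ev mu (E j) * mass (N j) z.
  have [k kK kP] := patT n (fun z => 0 <= l z).
  have [k' k'K k'P] := patT n (fun z => ~~ (0 <= l z)).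
  pose h z := -1 * b k' z + b k z.
  have h1 z : `|h z| <= 1.
    by rewrite /h ler_norml; have := b01 k z; have := b01 k' z; lra.
  have Ch : C (h \o Phi) by apply: (Clin (-1)); exact: Cb.
  apply: le_trans (le_trans (ler_norm _) (le_ev mu (fun x => h1 (Phi x)))).
  rewrite (expand mu n.+1 (h \o Phi))//; last first.
    by move=> j nj; rewrite -ev_push ev_lin !(Nb n.+1)// mulr0 addr0.
  rewrite big_mkord; apply: ler_sum => i _; rewrite -ev_push (Nmass i i.+1)//.
  rewrite /w mulr_sumr mulr_suml big_seq [leRHS]big_seq; apply: ler_sum => z.
  rewrite mem_undup => /(TS _ n.+1 (ltn_ord i)) zT.
  have [->|mz] := eqVneq (mass (N i) z) 0; first by rewrite normr0 !mul0r mulr0.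
  have lE : l z = ev mu (E i) * mass (N i) z.
    rewrite /l (bigD1 i)//= big1 ?addr0// => j ji.
    by rewrite (mass_disj i j) ?mulr0// eq_sym.
  rewrite /h kP// k'P// lE -normrM; set c := ev mu (E i); set d := mass _ _.
  by case: ger0P => _ /=; rewrite ?mulr0n ?mulr1n; lra.
have a_zero mu i : (forall g, Z' g -> ev mu g = 0) ->
    y i \notin [seq Phi x | x <- supp mu] -> ev mu (E i) = 0.
  move=> mu0 yi; apply: contrapT => /eqP ai.
  have eta0 : 0 < `|mass (N i) (y i) * ev mu (E i)|.
    by rewrite normr_gt0 mulf_neq0 ?massy.
  have w0 j : 0 <= w j by rewrite sumr_ge0.
  (* b k is 1 at the atom y i and 0 at the other points of T n0 and of        *)
  (* Phi (supp mu): only a_i * mass (N i) (y i) and a small tail survive.     *)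
  have [n0 in0 n0P] := summable_tail i.+1 (fun j => mulr_ge0 (normr_ge0 _) (w0 j))
    (fun n => a_bound mu n mu0) eta0.
  have [k kP] := b_pattern (T n0 ++ [seq Phi x | x <- supp mu]) (pred1 (y i)).
  have := expand mu (maxn n0 k.+1) (b k \o Phi) mu0 (Cb k).
  rewrite (_ : ev mu _ = 0); last first.
    rewrite -(ev0 mu); apply: eq_ev => x xmu /=.
    have xP : Phi x \in [seq Phi x | x <- supp mu] by apply: map_f.
    by rewrite kP ?mem_cat ?xP ?orbT//=; case: eqP yi => // <-; rewrite xP.
  have Kk : (k < K (maxn n0 k.+1))%N by apply: leq_trans (Kge _); exact: leq_maxr.
  move=> /(_ (fun j mj => etrans (esym (ev_push _ _ _)) (Nb _ _ _ mj Kk))).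
  rewrite -(big_mkord xpredT (fun j => ev (nu j) (b k \o Phi) * ev mu (E j))).
  rewrite (big_cat_nat (leq0n _) (leq_maxl n0 k.+1))//= big_mkord (bigD1 (Ordinal in0))//=.
  rewrite big1 => [|j ji]; last first.
    rewrite -ev_push (_ : ev _ _ = mass (N j) (y i)); last first.
      apply: eq_ev => z /suppT /(TS _ n0 (ltn_ord j)) zT.
      by rewrite kP// mem_cat zT.
    by rewrite (mass_disj i j) ?massy// ?mul0r// eq_sym.
  rewrite -ev_push (_ : ev (push Phi (nu i)) _ = mass (N i) (y i)); last first.
    apply: eq_ev => z /suppT /(TS _ n0 in0) zT.
    by rewrite kP// mem_cat zT.
  rewrite addr0 => /esym/eqP; rewrite addr_eq0 => /eqP massE.
  have := n0P (maxn n0 k.+1); rewrite massE normrN ltNge => /negP; apply.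
  apply: le_trans (ler_norm_sum _ _ _) _; apply: ler_sum => j _.
  rewrite normrM mulrC -ev_push ler_wpM2l// le_w// => z.
  by have := b01 k z; rewrite ler_norml; lra.
have y_inj i j : (i < j)%N -> y i != y j.
  move=> ij; apply/eqP => yij; have := massTS i.+1 j (y i) ij (mem_mass _ _ (massy i)).
  by rewrite yij; apply/eqP; exact: massy.
move=> P.
(* The atoms [y i] are distinct, so all but finitely many of them avoid the finite image of P. *)
have [n yn] : exists n, forall i, (n <= i)%N -> y i \notin [seq Phi x | x <- P].
  elim: [seq _ | _ <- P] => [|z s [n ns]]; first by exists 0%N.
  have [[j yj]|yz] := pselect (exists j, y j = z).
    exists (maxn n j.+1) => i; rewrite geq_max => /andP[ni ji].
    by rewrite inE negb_or ns// -yj eq_sym y_inj.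
  by exists n => i ni; rewrite inE negb_or ns// andbT; apply/eqP => yi; apply: yz; exists i.
exists n => f Cf fn.
have [[g [Cg Zg] gf]|[mu [muP mu0 muf]]] := interpolation_dual P f Z'0 Z'lin.
  by exists g.
have ai i : (n <= i)%N -> ev mu (E i) = 0.
  move=> ni; apply: a_zero => //; apply: contra (yn _ ni) => /mapP[x xmu ->].
  by rewrite map_f// muP.
(* If f has no interpolant, mu has only the coefficients a_i with i < n. Subtracting the a_i nu_i
   leaves a measure that kills all [b k \o Phi], hence C, yet takes the value 1 at f. *)
pose m := foldr (fun i m => scale (- ev mu (E i)) (nu i) ++ m) mu (iota 0 n).
have evm h : ev m h = ev mu h - \sum_(0 <= i < n) ev mu (E i) * ev (nu i) h.
  rewrite /m /index_iota subn0; elim: (iota 0 n) => [|i s IHs] /=.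
    by rewrite big_nil subr0.
  by rewrite ev_cat ev_scale IHs big_cons; ring.
have Zm : annih m.
  rewrite /m; elim: (iota 0 n) => [|i s IHs] /=; last exact: annih_lin.
  by move=> g Zg; apply: mu0; split=> [|i]; [exact: ZC|exact: nuZ].
have : ev m f = 0.
  apply: (annih_inj Zm) => // g; rewrite -ev_push; apply: b_total => k {g}.
  rewrite ev_push evm (expand mu (maxn n k.+1) (b k \o Phi))//; last first.
    move=> j mj; rewrite -ev_push (Nb _ _ _ mj)//.
    by apply: leq_trans (Kge _); exact: leq_maxr.
  rewrite -(big_mkord xpredT (fun j => ev (nu j) (b k \o Phi) * ev mu (E j))).
  rewrite (big_cat_nat (leq0n _) (leq_maxl n k.+1))//= [X in _ + X - _]big1_seq; last first.
    by move=> j; rewrite mem_index_iota => /andP[_ /andP[/ai -> _]]; rewrite mulr0.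
  by rewrite addr0; under eq_bigr do rewrite mulrC; rewrite subrr.
rewrite evm muf big1_seq => [|i]; last first.
  by rewrite mem_index_iota => /andP[_ /andP[_ /fn ->]]; rewrite mulr0.
by rewrite subr0 => /eqP; rewrite oner_eq0.
Qed.

End biorthogonal.

(** * Countably many functions realising all finite 0/1 patterns *)

Section separating_family.
Context (R : realType).
Implicit Types y z : nat -> R.

(* This is min(1, max(0, t)), in a form whose continuity is that of the norm. *)
Definition clamp (t : R) : R := (1 + `|t| - `|t - 1|) / 2.

(** Integer coefficients keep the family countable. *)
Definition cell (c : nat * int * int) y : R :=
  clamp (c.1.2%:~R * y c.1.1 + c.2%:~R).

Definition prod_cells (l : seq (nat * int * int)) y : R := \prod_(c <- l) cell c y.

(** A continuous disjunction: 1 as soon as one product is 1, and 0 when all products are 0. *)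
Definition join_cells (s : seq (seq (nat * int * int))) y : R :=
  1 - \prod_(l <- s) (1 - prod_cells l y).

Definition separating_family (k : nat) : (nat -> R) -> R :=
  join_cells (odflt [::] (unpickle k)).

Lemma clamp_itv t : 0 <= clamp t <= 1.
Proof. by rewrite /clamp; case: (ger0P t); case: (ger0P (t - 1)); lra. Qed.

Lemma clamp0 t : t <= 0 -> clamp t = 0.
Proof. by move=> t0; rewrite /clamp ler0_norm// ler0_norm; lra. Qed.

Lemma clamp1 t : 1 <= t -> clamp t = 1.
Proof. by move=> t1; rewrite /clamp !ger0_norm; lra. Qed.

Lemma prod_itv (I : Type) (s : seq I) (F : I -> R) :
  (forall i, 0 <= F i <= 1) -> 0 <= \prod_(i <- s) F i <= 1.
Proof.
move=> F01; elim/big_rec: _ => [|i x _ /andP[x0 x1]]; first by rewrite ler01 lexx.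
by have /andP[F0 F1] := F01 i; rewrite mulr_ge0// mulr_ile1.
Qed.

Lemma separating_family_itv k y : 0 <= separating_family k y <= 1.
Proof.
have sub01 (x : R) : 0 <= x <= 1 -> 0 <= 1 - x <= 1 by lra.
apply/sub01/prod_itv => l; apply/sub01/prod_itv => c; exact: clamp_itv.
Qed.

Lemma cell_separates y z : y != z -> exists c, cell c y = 1 /\ cell c z = 0.
Proof.
move=> yz; have [n ynz] : exists n, y n != z n.
  apply: contrapT => /forallNP yE; move/eqP: yz; apply; apply/funext => n.
  by apply/eqP/negPn/negP; exact: yE.
(* The gap 2 leaves one unit for rounding [a%:~R * z n] to an integer and one for the ramp of
   [clamp]. *)
have [a a2] : exists a : int, 2 <= a%:~R * (y n - z n).
  have d0 : 0 < `|y n - z n| by rewrite normr_gt0 subr_eq0.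
  have := archi_boundP (divr_ge0 (ler0n R 2) (ltW d0)); rewrite ltr_pdivrMr//.
  set k := Num.bound _ => k2.
  move: k2; have [d|d] := ger0P (y n - z n) => k2.
    by exists (Posz k); exact: ltW.
  by exists (- Posz k); rewrite rmorphN/= mulNr -mulrN; exact: ltW.
exists (n, a, - Num.floor (a%:~R * z n) - 1).
have /andP[] := floor_itv (a%:~R * z n).
rewrite /cell/= rmorphB rmorphN rmorphD/= => fl1 fl2.
by split; [apply: clamp1|apply: clamp0]; lra.
Qed.

Lemma prod_cells_isolates y (T : seq (nat -> R)) : exists l,
  prod_cells l y = 1 /\ {in T, forall z, z != y -> prod_cells l z = 0}.
Proof.
elim: T => [|z T [l [ly lT]]].
  by exists [::]; split=> //; rewrite /prod_cells big_nil.
have [zy|] := eqVneq z y.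
  exists l; split=> // x; rewrite inE => /orP[/eqP->|]; last exact: lT.
  by rewrite zy eqxx.
rewrite eq_sym => /cell_separates[c [cy cz]]; exists (c :: l).
rewrite /prod_cells big_cons cy mul1r; split=> // x.
rewrite inE big_cons => /orP[/eqP->|/lT xT /xT]; first by rewrite cz mul0r.
by rewrite /prod_cells => ->; rewrite mulr0.
Qed.

Lemma separating_family_pattern (T : seq (nat -> R)) (p : (nat -> R) -> bool) :
  exists k, {in T, forall y, separating_family k y = (p y)%:R}.
Proof.
have [s sP] : exists s, {in T, forall y, join_cells s y = (p y)%:R}.
  have /choice[l lP] y := prod_cells_isolates y T.
  exists [seq l y | y <- [seq y <- T | p y]] => y yT.
  rewrite /join_cells big_map; have [py|py] := boolP (p y).
    rewrite (big_rem y) ?mem_filter ?py//=.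
    by have [-> _] := lP y; rewrite subrr mul0r subr0.
  rewrite big1_seq ?subrr// => x /andP[_]; rewrite mem_filter => /andP[px xT].
  have [_ -> //] := lP x; first by rewrite subr0.
  by apply: contraNneq py => ->.
by exists (pickle s) => y yT; rewrite /separating_family pickleK/= sP.
Qed.

Lemma separating_family_continuous (X : topologicalType) (d : nat -> X -> R) k :
  (forall n, continuous (d n)) ->
  continuous (separating_family k \o (fun x n => d n x)).
Proof.
move=> cd.
have prodc (I : Type) (s : seq I) (F : I -> X -> R) :
    (forall i, continuous (F i)) -> continuous (fun x => \prod_(i <- s) F i x).
  move=> cF; elim: s => [|i s IHs] x.
    by under eq_fun do rewrite big_nil; exact: cvg_cst.
  by under eq_fun do rewrite big_cons; apply: cvgM; [exact: cF|exact: IHs].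
have subc (F : X -> R) : continuous F -> continuous (fun x => 1 - F x).
  by move=> cF x; apply: cvgB; [exact: cvg_cst|exact: cF].
apply: (subc (fun x => \prod_(l <- _) (1 - prod_cells l (fun n => d n x)))).
apply/prodc => l; apply/subc; apply/prodc => c x.
have cvgt : c.1.2%:~R * d c.1.1 t + c.2%:~R @[t --> x]
    --> (c.1.2%:~R * d c.1.1 x + c.2%:~R : R).
  by apply: cvgD; [apply: cvgM; [exact: cvg_cst|exact: cd]|exact: cvg_cst].
apply: cvgM; last exact: cvg_cst.
apply: cvgB; first by apply: cvgD; [exact: cvg_cst|exact: cvg_norm].
by apply: cvg_norm; apply: cvgB; [exact: cvgt|exact: cvg_cst].
Qed.

End separating_family.

(** * Quotients of C_p(X) *)

Local Open Scope quotient_scope.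

Section Cp_topology.
Context (R : realType) (X : topologicalType).
Implicit Types (f g : Cp X R) (m : seq (R * X)).

Lemma Cp_valD f g : Cp_val (f + g) = fun x => Cp_val f x + Cp_val g x.
Proof. by []. Qed.

Lemma Cp_valB f g : Cp_val (f - g) = fun x => Cp_val f x - Cp_val g x.
Proof. by []. Qed.

Lemma Cp_val0 : Cp_val (0 : Cp X R) = fun=> 0.
Proof. by []. Qed.

Lemma Cp_val_lin a f g :
  Cp_val (a *: f + g) = fun x => a * Cp_val f x + Cp_val g x.
Proof. by []. Qed.

Lemma Cp_val_sum n (c : 'I_n -> R) (e : 'I_n -> Cp X R) :
  Cp_val (\sum_(i < n) c i *: e i) = fun x => \sum_(i < n) c i * Cp_val (e i) x.
Proof.
elim: n c e => [|n IHn] c e; apply/funext => x; first by rewrite !big_ord0.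
by rewrite big_ord_recr Cp_valD IHn big_ord_recr.
Qed.

Lemma Cp_continuous f : continuous (Cp_val f).
Proof. exact: cts_fun. Qed.

Lemma Cp_valK (F : X -> R) : continuous F -> exists f, Cp_val f = F.
Proof. by move=> cF; exists (Cp_sub (asboolT cF)). Qed.

Lemma eval_continuous x : continuous (fun f => Cp_val f x).
Proof.
move=> f; have projc := @proj_continuous X (fun=> R) x (Cp_val f).
have valc := @initial_continuous (Cp X R) {ptws X -> R} (@Cp_val X R) f.
exact: (@continuous_comp (Cp X R) {ptws X -> R} R _ _ f valc projc).
Qed.

Lemma ev_continuous m : continuous (fun f => ev m (Cp_val f)).
Proof.
rewrite /ev; elim: m => [|p m IHm] f.
  by under eq_fun do rewrite big_nil; exact: cst_continuous.
under eq_fun do rewrite big_cons; rewrite /continuous_at.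
apply: (@cvgD _ _ _ (nbhs f)); last exact: IHm.
by apply: cvgM; [exact: cvg_cst|exact: eval_continuous].
Qed.

Lemma nbhs_Cp f (U : set (Cp X R)) : nbhs f U <->
  exists (P : seq X) (e : R), 0 < e /\
    [set g | {in P, forall x, `|Cp_val f x - Cp_val g x| < e}] `<=` U.
Proof.
split=> [|[P [e [e0 PU]]]]; last first.
  apply: filterS PU _; elim: P => [|x P IHP]; first exact: filterE.
  have fx : nbhs f [set g | `|Cp_val f x - Cp_val g x| < e].
    by have /cvgr_dist_lt/(_ _ e0) := @eval_continuous x f.
  apply: filterS (filterI fx IHP) => g [gx gP] y.
  by rewrite inE => /orP[/eqP->|/gP].
pose B (p : seq X * R) :=
  [set g | {in p.1, forall x, `|Cp_val f x - Cp_val g x| < p.2}].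
pose F := filter_from [set p : seq X * R | 0 < p.2] B.
have FF : Filter F.
  apply: filter_from_filter; first by exists ([::], 1) => /=.
  move=> [P e] [Q d]/= e0 d0; exists (P ++ Q, Num.min e d).
    by rewrite /= lt_min e0.
  move=> g /= gPQ; split=> x /= xP.
    have := gPQ x; rewrite mem_cat xP => /(_ isT); rewrite lt_min.
    by case/andP.
  by have := gPQ x; rewrite mem_cat xP orbT => /(_ isT); rewrite lt_min => /andP[].
have cF : (@Cp_val X R : _ -> {ptws X -> R}) @ F --> (Cp_val f : {ptws X -> R}).
  apply/pointwise_cvgP => x; apply/cvgrPdist_lt => e e0.
  by exists ([:: x], e) => //= g; apply; rewrite inE.
rewrite nbhsE => -[_ [[V oV <-] Vf] VU].
have /cF [[P e] /= e0 BV] : nbhs (Cp_val f : {ptws X -> R}) V.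
  exact: open_nbhs_nbhs.
by exists P, e; split=> //; apply: subset_trans VU.
Qed.

End Cp_topology.

(** * Properties of a quotient read off the annihilator *)

Section Cp_quotient.
Context (R : realType) (X : topologicalType) (Z : submodClosed (Cp X R)).
Implicit Types (f g : Cp X R) (m : seq (R * X)).
Local Notation Y := (linear_quotient Z).

Lemma pi_eq f g : (\pi_Y f = \pi_Y g) <-> (f - g \in Z).
Proof. by split=> /linear_quotient_eqP. Qed.

Lemma linear_quotient_pi_continuous :
  continuous (\pi_Y : Cp X R -> linear_quotient Z).
Proof. exact: pi_continuous. Qed.

Lemma pi0 : \pi_Y 0 = 0.
Proof. by apply: (addrI (\pi_Y 0)); rewrite -linear_quotient_piD !addr0. Qed.

Lemma pi_sum n (c : 'I_n -> R) (e : 'I_n -> Cp X R) :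
  \pi_Y (\sum_(i < n) c i *: e i) = \sum_(i < n) c i *: \pi_Y (e i).
Proof.
elim: n c e => [|n IHn] c e; first by rewrite !big_ord0 pi0.
rewrite !big_ord_recr/= linear_quotient_piD IHn; congr (_ + _).
by rewrite -linear_quotient_piZ.
Qed.

Definition zero_set : set (X -> R) := [set Cp_val f | f in [set f | f \in Z]].

Definition annihilator : set (seq (R * X)) :=
  [set m | forall u : X -> R, zero_set u -> ev m u = 0].

Lemma ev_pi m f g : annihilator m -> \pi_Y f = \pi_Y g ->
  ev m (Cp_val f) = ev m (Cp_val g).
Proof.
move=> Zm /pi_eq fgZ; apply/eqP; rewrite -subr_eq0 -evB; apply/eqP.
by apply: (Zm (Cp_val (f - g))); exists (f - g).
Qed.

Lemma ev_repr m f : annihilator m ->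
  ev m (Cp_val (repr (\pi_Y f))) = ev m (Cp_val f).
Proof. by move=> Zm; apply: ev_pi => //; rewrite reprK. Qed.

Lemma ev_repr_continuous m : annihilator m ->
  continuous (fun q : Y => ev m (Cp_val (repr q))).
Proof.
move=> Zm; apply: (repr_comp_continuous (@ev_continuous _ _ m)).
by move=> f g /eqP fg; apply/eqP/ev_pi.
Qed.

Lemma zero_set_lin a (u v : X -> R) :
  zero_set u -> zero_set v -> zero_set (fun x => a * u x + v x).
Proof.
move=> [f fZ <-] [f' f'Z <-]; exists (a *: f + f') => //.
by rewrite /= rpredD// rpredZ.
Qed.

Lemma zero_set0 : zero_set (fun=> 0).
Proof. by exists 0 => //=; exact: rpred0. Qed.

(** Without such a measure, every neighbourhood of the class of f, being controlled by a finite set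
    P, contains the class of some g in Z agreeing with f on P, that is, the zero class. *)
Lemma annihilator_separates f : hausdorff_space Y -> f \notin Z ->
  exists m, annihilator m /\ ev m (Cp_val f) = 1.
Proof.
move=> hY fZ; apply: contrapT => nom; move/negP: fZ; apply.
rewrite -[f]subr0; apply/pi_eq; apply: hY => A B.
move=> /linear_quotient_pi_continuous /nbhs_Cp[P [e [e0 PA]]] B0.
have [[_ [g gZ <-] gf]|[m [_ mZ mf]]] :=
    interpolation_dual P (Cp_val f) zero_set0 zero_set_lin; last first.
  by case: nom; exists m; split=> //; exact: mZ.
exists (\pi_Y g); split.
  by apply: PA => x xP; rewrite (gf x xP) subrr normr0.
have -> : \pi_Y g = \pi_Y 0 by apply/pi_eq; rewrite subr0.
exact: nbhs_singleton.
Qed.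

(** Functions spanning C(X) modulo the kernel of the annihilator have classes spanning the quotient,
    since the annihilator detects non-membership in Z. *)
Lemma annihilator_unspanned : hausdorff_space Y -> infinite_dimensional Y ->
  ~ spanned [set g : X -> R | continuous g] annihilator.
Proof.
move=> hY infY [n [e [ce spane]]]; apply: infY.
have /choice[e' e'E] i := Cp_valK (ce i).
exists n, (fun i => \pi_Y (e' i)) => v.
have [c cE] := spane _ (@Cp_continuous _ _ (repr v)).
exists c; rewrite -[LHS]reprK -pi_sum; apply/pi_eq; apply: contrapT => /negP.
move=> /(annihilator_separates hY)[m [Zm]].
rewrite Cp_valB Cp_val_sum evB cE// ev_sum.
under [X in _ - X]eq_bigr do rewrite evZ e'E.
by rewrite subrr => /eqP; rewrite eq_sym oner_eq0.
Qed.

(** The d n lift a countable dense set; a measure in the annihilator induces a continuous functional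
    on the quotient, determined by its values there. *)
Lemma separable_annihilator : separable_space Y ->
  exists d : nat -> Cp X R, forall m, annihilator m ->
    (forall n, ev m (Cp_val (d n)) = 0) -> forall f, ev m (Cp_val f) = 0.
Proof.
move=> [D /countable_injP[code code_inj] denseD].
have /choice[d dP] n : exists f, forall q, D q -> code q = n -> \pi_Y f = q.
  have [[q Dq qn]|noq] := pselect (exists2 q, D q & code q = n).
    exists (repr q) => q' Dq' q'n; rewrite reprK; apply: code_inj.
    - by rewrite inE.
    - by rewrite inE.
    - by rewrite qn.
  by exists 0 => q Dq qn; exfalso; apply: noq; exists q.
exists d => m Zm md f; apply: contrapT => /eqP mf.
pose O := [set q : Y | `|ev m (Cp_val f) - ev m (Cp_val (repr q))|
                       < `|ev m (Cp_val f)|].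
have [] : O `&` D !=set0.
  apply: denseD.
    by exists (\pi_Y f); rewrite /O/= ev_repr// subrr normr0 normr_gt0.
  have /continuousP := ev_repr_continuous Zm.
  by move=> /(_ _ (ball_open (ev m (Cp_val f)) `|ev m (Cp_val f)|)).
move=> q [Oq Dq]; move: Oq; rewrite /O/=.
by rewrite -(dP _ q Dq erefl) ev_repr// md subr0 ltxx.
Qed.

End Cp_quotient.

(** * From metrisable to separable quotients *)

Lemma inv_nat_lt (R : realType) (e : R) : 0 < e ->
  exists n : nat, n.+1%:R^-1 < e.
Proof.
move=> e0; exists (Num.bound e^-1).
rewrite -[ltRHS]invrK ltf_pV2 ?posrE ?invr_gt0//.
by apply: lt_le_trans (archi_boundP (ltW _)) _; rewrite ?invr_gt0// ler_nat.
Qed.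

Lemma metrisable_hausdorff (R : realType) (T : topologicalType) :
  metrisable_space R T -> hausdorff_space T.
Proof.
move=> [d [d0 dsep dC dtri nbhsd]] p q pq; apply: dsep.
have dball x e : 0 < e -> nbhs x [set y | d x y < e].
  by rewrite nbhsd => e0; exists e.
have d_ge0 x y : 0 <= d x y.
  by have := dtri y x x; rewrite d0 (dC y x); lra.
apply/eqP; rewrite eq_le d_ge0 andbT leNgt; apply/negP => dpq.
have e0 : 0 < d p q / 2 by rewrite divr_gt0.
have [z [/= pz qz]] := pq _ _ (dball p _ e0) (dball q _ e0).
by have := dtri z p q; rewrite (dC z q); lra.
Qed.

Lemma metrisable_separable (R : realType) (X : topologicalType)
    (Z : submodClosed (Cp X R)) :
  metrisable_space R (linear_quotient Z) -> separable_space (linear_quotient Z).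
Proof.
move=> [d [_ _ _ _ nbhsd]].
pose pi := \pi_(linear_quotient Z).
have /choice[P /choice[eps Peps]] (n : nat) : exists P : seq X, exists e : R,
    0 < e /\ forall g : Cp X R, {in P, forall x, `|Cp_val g x| < e} ->
      d 0 (pi g) < n.+1%:R^-1.
  have : nbhs (pi 0) [set q | d 0 q < n.+1%:R^-1 :> R].
    by rewrite /pi pi0 nbhsd; exists (n.+1%:R^-1) => //=; rewrite invr_gt0.
  move=> /linear_quotient_pi_continuous/nbhs_Cp[P [e [e0 PU]]]; exists P, e.
  split=> // g gP; apply: PU => x xP.
  by rewrite Cp_val0 sub0r normrN gP.
(* One function is chosen for each attainable tuple of rational values on P n, giving countably
   many. With tolerance [eps n / 2], two functions matching the same tuple differ by less than
   [eps n] on P n. *)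
pose approx (n : nat) (r : seq rat) (g : Cp X R) := {in P n, forall x,
  `|Cp_val g x - ratr (nth 0 r (index x (P n)))| < eps n / 2}.
have /choice[F FP] (p : nat * seq rat) : exists h : Cp X R,
    forall g, approx p.1 p.2 g -> approx p.1 p.2 h.
  have [[h ph]|noh] := pselect (exists h, approx p.1 p.2 h); first by exists h.
  by exists 0 => g pg; case: noh; exists g.
exists (range (pi \o F)).
  exact: (sub_countable (card_image_le _ _) (countableP _)).
move=> O [q Oq] oO; pose f := repr q.
(* Translating O by the class of f gives a neighbourhood of 0: its preimage in C_p(X) is open, which
   is openness in the quotient. *)
have [n nP] : exists n, forall g : Cp X R,
    d 0 (pi g) < n.+1%:R^-1 -> O (pi (f + g)).
  have oV : open ([set v | O (pi f + v)] : set (linear_quotient Z)).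
    have oA : open [set g : Cp X R | O (pi (f + g))].
      rewrite openE => g /= Og.
      have := open_nbhs_nbhs (conj oO Og).
      move=> /linear_quotient_pi_continuous/nbhs_Cp[Q [e [e0 QO]]].
      apply/nbhs_Cp; exists Q, e; split=> // h hQ; apply: QO => x xQ.
      by rewrite !Cp_valD opprD addrACA subrr add0r hQ.
    suff : open (pi @^-1` [set v | O (pi f + v)]) by [].
    rewrite (_ : _ @^-1` _ = [set g | O (pi (f + g))])//.
    by apply/seteqP; split=> g /=; rewrite /pi linear_quotient_piD.
  have : nbhs (0 : linear_quotient Z) [set v | O (pi f + v)].
    by apply: open_nbhs_nbhs; split=> //=; rewrite addr0 /pi reprK.
  rewrite nbhsd => -[e /= e0 eO].
  have [n ne] := inv_nat_lt e0; exists n => g gn; rewrite /pi linear_quotient_piD; apply: eO => /=.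
  exact: lt_trans gn ne.
have [eps0 dP] := Peps n.
have /choice[rx rxP] x : exists r : rat, `|Cp_val f x - ratr r| < eps n / 2.
  have [r] := @rat_in_itvoo R (Cp_val f x - eps n / 2) (Cp_val f x + eps n / 2)
    ltac:(lra).
  by rewrite in_itv/= => /andP[r1 r2]; exists r; rewrite ltr_norml; lra.
have fr : approx n [seq rx x | x <- P n] f.
  move=> x xP; rewrite (nth_map x) ?index_mem// nth_index//.
exists (pi (F (n, [seq rx x | x <- P n]))); split; last by exists (n, [seq rx x | x <- P n]).
have Fr := FP (n, _) _ fr; set h := F _ in Fr *.
rewrite -[h](subrK f) addrC; apply/nP/dP => x xP.
rewrite Cp_valB; have := fr x xP; have := Fr x xP.
by rewrite !ltr_norml; lra.
Qed.

Lemma min_subadditive (R : realDomainType) (c x y z : R) :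
  0 <= c -> 0 <= y -> 0 <= z -> x <= y + z ->
  Num.min c x <= Num.min c y + Num.min c z.
Proof. by case: (leP c x); case: (leP c y); case: (leP c z); lra. Qed.

(** * The quotient by the common kernel of a sequence of measures *)

Section nullspace.
Context (R : realType) (X : topologicalType) (nu : nat -> seq (R * X)).

Definition nullspace : {pred Cp X R} :=
  fun f => `[< forall i, ev (nu i) (Cp_val f) = 0 >].

Fact nullspace_submod_closed : submod_closed nullspace.
Proof.
split=> [|a f g /asboolP nf /asboolP ng]; apply/asboolP => i.
  by rewrite Cp_val0 ev0.
by rewrite Cp_val_lin ev_lin nf ng mulr0 addr0.
Qed.

HB.instance Definition _ :=
  GRing.isSubmodClosed.Build R (Cp X R) nullspace nullspace_submod_closed.

Local Notation Y := (linear_quotient nullspace).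

Lemma nullspace_annihilator i : annihilator nullspace (nu i).
Proof. by move=> _ [f /asboolP nf <-]; exact: nf. Qed.

(** A spanning family of size n would factor the identity matrix of size n+1 through dimension n. *)
Lemma nullspace_infinite_dimensional (E : nat -> Cp X R) :
  (forall i j, ev (nu i) (Cp_val (E j)) = (i == j)%:R) ->
  infinite_dimensional Y.
Proof.
move=> nuE [n [e spane]].
have /choice[c cE] (j : 'I_n.+1) := spane (\pi_Y (E j)).
pose A := \matrix_(j < n.+1, i < n) c j i.
pose B := \matrix_(i < n, k < n.+1) ev (nu k) (Cp_val (repr (e i))).
suff /mulmx1_min : A *m B = 1%:M by rewrite ltnn.
apply/matrixP => j k; rewrite !mxE eq_sym -nuE.
have /pi_eq : \pi_Y (\sum_(i < n) c j i *: repr (e i)) = \pi_Y (E j).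
  by rewrite pi_sum cE; apply: eq_bigr => i _; rewrite reprK.
move=> /asboolP /(_ k); rewrite Cp_valB evB => /eqP; rewrite subr_eq0 => /eqP <-.
rewrite Cp_val_sum ev_sum; apply: eq_bigr => i _.
by rewrite !mxE evZ.
Qed.

Let phi i (q : Y) := ev (nu i) (Cp_val (repr q)).

(** The cap makes all but finitely many coordinates negligible at any given scale, so the supremum
    induces the initial topology of the [phi i]. *)
Let term (p q : Y) i : R := Num.min i.+1%:R^-1 `|phi i p - phi i q|.

Let dist (p q : Y) : R := sup (range (term p q)).

Let term_le_dist p q i : term p q i <= dist p q.
Proof.
apply: sup_upper_bound; last by exists i.
split; first by exists (term p q 0), 0.
exists 1 => _ [j _ <-]; rewrite ge_min; apply/orP; left.
by rewrite invf_le1 ?ltr0n// ler1n.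
Qed.

Let dist_le p q b : (forall i, term p q i <= b) -> dist p q <= b.
Proof.
move=> qb; apply: ge_sup => [|_ [j _ <-]]; last exact: qb.
by exists (term p q 0), 0.
Qed.

Lemma nullspace_metrisable (E : nat -> X -> R) :
  (forall i, continuous (E i)) ->
  (forall i j, ev (nu i) (E j) = (i == j)%:R) ->
  (forall P : seq X, exists n, forall f, continuous f ->
    (forall i, (i < n)%N -> ev (nu i) f = 0) ->
    exists g, [/\ continuous g, forall i, ev (nu i) g = 0 & {in P, g =1 f}]) ->
  metrisable_space R Y.
Proof.
move=> cE nuE interp.
have term_ge0 p q i : 0 <= term p q i by rewrite le_min invr_ge0 ler0n normr_ge0.
exists dist; split.
- move=> q; apply/le_anti; apply/andP; split; last exact: le_trans (term_le_dist q q 0).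
  by apply: dist_le => i; rewrite /term subrr normr0 ge_min lexx orbT.
- move=> p q pq; rewrite -[p]reprK -[q]reprK; apply/pi_eq/asboolP => i.
  rewrite Cp_valB evB; apply/eqP; rewrite -normr_le0.
  have := term_le_dist p q i; rewrite pq /term ge_min.
  by case/orP => //; rewrite leNgt invr_gt0 ltr0Sn.
- move=> p q; rewrite /dist (_ : term p q = term q p)//.
  by apply/funext => i; rewrite /term distrC.
- move=> q p r; apply: dist_le => i.
  apply: le_trans (lerD (term_le_dist p q i) (term_le_dist q r i)).
  by apply: min_subadditive => //; exact: ler_distD.
move=> p; apply/seteqP; split=> U; last first.
  move=> [e /= e0 eU]; apply: filterS eU _; have [n ne] := inv_nat_lt e0.
  have : nbhs p [set q | forall i, (i < n)%N -> `|phi i p - phi i q| < e / 2].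
    elim: n {ne} => [|n IHn]; first exact: filterE.
    have cphi := @ev_repr_continuous _ _ _ _ (nullspace_annihilator n) p.
    have /cvgrPdist_lt/(_ _ (divr_gt0 e0 (ltr0Sn _ 1))) pn := cphi.
    apply: filterS (filterI IHn pn) => q [qn qE] i.
    by rewrite ltnS leq_eqVlt => /orP[/eqP->|]; [exact: qE|exact: qn].
  apply: filterS => q /= pq; apply: (@le_lt_trans _ _ (Num.max (e / 2) n.+1%:R^-1)).
    apply: dist_le => i; rewrite /term le_max !ge_min.
    have [/pq/ltW -> |ni] := ltnP i n; first by rewrite orbT.
    by rewrite [X in _ || (X || _)]lef_pV2 ?posrE// ler_nat ltnS ni orbT.
  by rewrite gt_max ne andbT; lra.
rewrite -{1}[p]reprK => /linear_quotient_pi_continuous/nbhs_Cp[P [e [e0 PU]]].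
have [n nP] := interp P.
pose B := \sum_(x <- P) \sum_(i < n) `|E i x|.
have B0 : 0 <= B by apply: sumr_ge0 => x _; exact: sumr_ge0.
(* The first bound makes the caps inactive for i < n; the second gives [delta * B < e], with 1 added
   to keep the denominator positive. *)
pose delta := Num.min n.+1%:R^-1 (e / (1 + B)).
have delta0 : 0 < delta.
  by rewrite lt_min invr_gt0 ltr0Sn divr_gt0//; lra.
exists delta => //= q pq.
have /choice[E' E'E] i := Cp_valK (cE i).
pose a i := phi i p - phi i q.
have adelta i : (i < n)%N -> `|a i| <= delta.
  move=> iln; have := le_lt_trans (term_le_dist p q i) pq.
  rewrite /term gt_min => /orP[|/ltW//]; rewrite lt_min => /andP[+ _].
  by rewrite ltf_pV2 ?posrE// ltr_nat ltnS ltnNge ltnW.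
(* Once its first n coordinates are removed, p - q can be replaced on P by some g in the kernel.
   Adding g to [repr q] keeps the class and leaves only the sum of the [a i * E i x] as distance to
   [repr p] on P. *)
pose f := repr p - repr q - \sum_(i < n) a i *: E' i.
have fE : Cp_val f = fun x =>
    Cp_val (repr p) x - Cp_val (repr q) x - \sum_(i < n) a i * E i x.
  rewrite /f !Cp_valB Cp_val_sum; apply/funext => x; congr (_ - _).
  by apply: eq_bigr => i _; rewrite E'E.
have [|g [cg ng gf]] := nP (Cp_val f) (@Cp_continuous _ _ f).
  move=> j jn; rewrite fE !evB ev_sum -/(phi j p) -/(phi j q) -/(a j).
  rewrite (bigD1 (Ordinal jn))//= evZ nuE eqxx mulr1 big1 ?addr0 ?subrr//.
  move=> i; rewrite -val_eqE/= evZ nuE eq_sym => /negPf ->.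
  by rewrite mulr0.
have [g' g'E] := Cp_valK cg.
have -> : q = \pi_Y (repr q + g').
  rewrite -[LHS]reprK; apply/esym/pi_eq/asboolP => i.
  by rewrite (addrC (repr q)) addrK g'E ng.
apply: PU => x xP; rewrite Cp_valD g'E (gf x xP) fE.
rewrite (_ : _ - _ = \sum_(i < n) a i * E i x); last by ring.
apply: (@le_lt_trans _ _ (delta * B)).
  rewrite /B (big_rem x)//= mulrDr -[leLHS]addr0 lerD//; last first.
    apply: mulr_ge0; first exact: ltW.
    by apply: sumr_ge0 => y _; exact: sumr_ge0.
  apply: le_trans (ler_norm_sum _ _ _) _; rewrite mulr_sumr.
  by apply: ler_sum => i _; rewrite normrM ler_wpM2r// adelta.
apply: (@le_lt_trans _ _ (e / (1 + B) * B)).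
  by rewrite ler_wpM2r// ge_min lexx orbT.
by rewrite mulrAC ltr_pdivrMr ?ltr_pM2l//; lra.
Qed.

End nullspace.

Local Close Scope quotient_scope.

Theorem theoremB (R : realType) (X : topologicalType)
    (compactX : compact [set: X]) (hausdorffX : hausdorff_space X) :
  (exists Z : submodClosed (Cp X R),
     [/\ infinite_dimensional (linear_quotient Z),
         hausdorff_space (linear_quotient Z)
       & separable_space (linear_quotient Z)])
  <->
  (exists Z : submodClosed (Cp X R),
     [/\ infinite_dimensional (linear_quotient Z),
         hausdorff_space (linear_quotient Z)
       & metrisable_space R (linear_quotient Z)]).
Proof.
split=> -[Z [infZ hZ]]; last first.
  by move=> mZ; exists Z; split=> //; exact: metrisable_separable mZ.
move=> /separable_annihilator[d dP].
(* Here Phi lists the values of the d n: a measure with zero image kills each coordinate composed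
   with Phi, that is each d n, and hence all of C(X). *)
have [||||||||nu [E [cE nuE interp]]] := @closed_biorthogonal_sequence R X _
    (fun x n => Cp_val (d n) x) [set g : X -> R | continuous g] (zero_set Z)
    (@separating_family R).
- by move=> x; exact: cvg_cst.
- move=> a g h cg ch x.
  by apply: cvgD; [apply: cvgM; [exact: cvg_cst|exact: cg]|exact: ch].
- exact: separating_family_itv.
- exact: separating_family_pattern.
- by move=> k; apply: separating_family_continuous => n; exact: Cp_continuous.
- move=> m Zm md f cf; have [f' <-] := Cp_valK cf.
  by apply: dP Zm _ _ => n; exact: (md (fun y => y n)).
- exact: annihilator_unspanned hZ infZ.
- by move=> _ [f _ <-]; exact: Cp_continuous.
have metr := nullspace_metrisable cE nuE interp.
have /choice[E' E'E] i := Cp_valK (cE i).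
eexists; split; last exact: metr; last exact: metrisable_hausdorff metr.
apply: (@nullspace_infinite_dimensional _ _ _ E') => i j.
by rewrite E'E.
Qed.
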